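(* Let $n\ge2$ and let $k$ be an integer with $0\le k<n$ and $k\equiv n\pmod 2$. The $h^*$-polynomial of the toric diagram $\mathcal{D}_k\subset\mathbb{R}^n$ is $$h^*_{\mathcal{D}_k}(z)=1+z+z^2+\cdots+z^{n-1}.$$
   Context: With $e_1,\dots,e_n$ the standard basis of $\mathbb{R}^n$, $\mathcal{D}_k=\operatorname{conv}(a_1,\dots,a_{n+2})$ where $$a_1=0,\quad a_{i+1}=e_i\ (1\le i\le n-1),\quad a_{n+1}=-e_{n-1}+e_n,\quad a_{n+2}=-\sum_{i=1}^{n-2}e_i-k\,e_{n-1}+\tfrac{n+k}{2}e_n.$$ For an integral $n$-polytope $\mathcal{P}$, with $L_{\mathcal{P}}(t)=\#(t\mathcal{P}\cap\mathbb{Z}^n)$, the $h^*$-polynomial $h^*_{\mathcal{P}}(z)$ is defined by $1+\sum_{t\ge1}L_{\mathcal{P}}(t)z^t=\dfrac{h^*_{\mathcal{P}}(z)}{(1-z)^{n+1}}$. *)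

(* Defs.v *)
From mathcomp Require Import all_boot all_order all_algebra finmap.
From mathcomp Require Import boolp classical_sets cardinality reals.

Set Implicit Arguments.
Unset Strict Implicit.
Unset Printing Implicit Defensive.

Import Order.TTheory GRing.Theory Num.Theory.

Local Open Scope classical_set_scope.
Local Open Scope ring_scope.

Definition conv (R : realType) (n m : nat) (a : 'I_m -> 'rV[R]_n) :
    set 'rV[R]_n :=
  [set x | exists c : 'I_m -> R,
    [/\ forall i, 0 <= c i, \sum_i c i = 1 & x = \sum_i c i *: a i]].

(* For bounded P the set below is finite, so that fset_set (which sends
   infinite sets to the empty one) does not lose any point. *)
Definition lattice_count (R : realType) (n : nat) (P : set 'rV[R]_n)
    (t : nat) : nat :=
  #|` fset_set ([set t%:R *: x | x in P] `&` [set x | x \is a mxOver Num.int])|.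

(* A formal power series is represented by its sequence of coefficients. *)
Definition ehrhart_series (R : realType) (n : nat) (P : set 'rV[R]_n)
    (t : nat) : int :=
  if t is 0 then 1 else (lattice_count P t)%:Z.

Definition cauchy_prod (a b : nat -> int) (m : nat) : int :=
  \sum_(i < m.+1) a i * b (m - i)%N.

(* The quotient h / (1 - z)^(n+1) is taken in the ring of formal power series:
   the identity is (1 - z)^(n+1) * (Ehrhart series) = h. *)
Definition is_hstar_poly (R : realType) (n : nat) (P : set 'rV[R]_n)
    (h : {poly int}) : Prop :=
  forall m : nat,
    cauchy_prod (nth 0 ((1 - 'X) ^+ n.+1 : {poly int})) (ehrhart_series P) m
      = h`_m.

Lemma is_hstar_poly_unique (R : realType) (n : nat) (P : set 'rV[R]_n)
    (h1 h2 : {poly int}) :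
  is_hstar_poly P h1 -> is_hstar_poly P h2 -> h1 = h2.
Proof. by move=> H1 H2; apply/polyP => m; rewrite -H1 -H2. Qed.

(* Indices of basis vectors and vertices are 1-based, coordinates of row
   vectors 0-based. *)
Definition std_basis (R : realType) (n i : nat) : 'rV[R]_n :=
  \row_(j < n) (j.+1 == i)%:R.

Definition toric_vertex (R : realType) (n k i : nat) : 'rV[R]_n :=
  let e := std_basis R n in
  if i == 1%N then 0
  else if (i <= n)%N then e i.-1
  else if i == n.+1 then - e n.-1 + e n
  else - (\sum_(1 <= j < n.-1) e j) - k%:R *: e n.-1
       + ((n + k)%:R / 2) *: e n.

Definition toric_diagram (R : realType) (n k : nat) : set 'rV[R]_n :=
  conv (fun i : 'I_n.+2 => toric_vertex R n k i.+1).

Arguments toric_diagram R n k : clear implicits.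

(* Main.v *)
(** The vertices satisfy a single affine relation
      a_1 + ... + a_(n-1) + a_(n+2) = p a_n + q a_(n+1),
    with p = (n - k)/2 and q = (n + k)/2, both positive, and p + q = n; any
    n + 1 of them that omit a vertex of the left-hand side form a unimodular
    simplex. Subtracting from a representation as large a multiple of the
    relation as possible, each lattice point of the t-th dilate is written in
    exactly one way as a combination with natural coefficients of sum t, one of
    which vanishes on the left-hand side. There are
    'C(n+1+t, n+1) - 'C(n+1+t-n, n+1) of them (the second term for n <= t
    only), and n + 1 multiplications by 1 - z leave the series
    (1 - z^n) / (1 - z). *)

Require Import Defs.
From mathcomp Require Import all_boot all_order all_algebra.
From mathcomp Require Import boolp classical_sets reals.
From mathcomp Require Import finmap cardinality.
From mathcomp Require Import zify ring lra.

Set Implicit Arguments.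
Unset Strict Implicit.
Unset Printing Implicit Defensive.
Import Order.TTheory GRing.Theory Num.Theory.

Local Open Scope ring_scope.

(** * Power series coefficients and counts of tuples of naturals *)

(** Coefficients of [b] beyond [m] do not enter, so the series may be truncated at any [N > m]; the
    ring laws of polynomials then become available. *)
Lemma cauchy_prodE (p : {poly int}) (b : nat -> int) (m N : nat) :
  (m < N)%N -> cauchy_prod (nth 0 p) b m = (p * \poly_(i < N) b i)`_m.
Proof.
move=> mN; rewrite coefM; apply: eq_bigr => i _; rewrite coef_poly.
by rewrite (leq_ltn_trans (leq_subr _ _) mN).
Qed.

Lemma cauchy_prod_1subX (p : {poly int}) (b : nat -> int) (m : nat) :
  cauchy_prod (nth 0 ((1 - 'X) * p)) b m =
  cauchy_prod (nth 0 p) (fun t => b t - (if t is u.+1 then b u else 0)) m.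
Proof.
rewrite !(@cauchy_prodE _ _ _ m.+1) // [_ * p]mulrC -mulrA !coefM.
apply: eq_bigr => i _; congr (_ * _).
rewrite mulrBl mul1r coefB coefXM !coef_poly.
by case: (m - i)%N (leq_subr i m) => [|j] jm; rewrite ?ltnS ?jm ?(ltnW jm).
Qed.

Lemma eq_cauchy_prod (a b b' : nat -> int) (m : nat) :
  b =1 b' -> cauchy_prod a b m = cauchy_prod a b' m.
Proof. by move=> eqb; apply: eq_bigr => i _; rewrite eqb. Qed.

(* Multiplying the series by 1 - z lowers [d] by one, by Pascal's rule. *)
Lemma cauchy_prod_binomial_diff (n d m : nat) : (0 < n)%N ->
  cauchy_prod (nth 0 ((1 - 'X) ^+ d : {poly int}))
    (fun t => 'C(d + t, d)%:Z
              - (if (n <= t)%N then 'C(d + (t - n), d) else 0%N)%:Z) m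
  = (m < n)%N%:R.
Proof.
move=> n_gt0; elim: d => [|d IHd].
  rewrite expr0 (@cauchy_prodE _ _ _ m.+1) // mul1r coef_poly ltnSn !bin0.
  by rewrite ltnNge; case: leqP.
rewrite exprS cauchy_prod_1subX -[RHS]IHd; apply: eq_cauchy_prod => -[|t].
  by rewrite !addn0 !binn leqNgt n_gt0 /= !subr0.
rewrite [LHS]/= [in X in X%:Z]addSn binS [(d.+1 + t)%N]addSnnS.
(* For [t + 1 < n] no subtracted term is present; for [t + 1 > n] Pascal's rule applies to them too;
   at [t + 1 = n] only the new one is present, and both sides subtract 1. *)
case: (ltngtP t.+1 n) => tn.
- by rewrite [(n <= t)%N]leqNgt ltnW //=; lia.
- have nt : (n <= t)%N by [].
  rewrite nt subSn // addSn binS [(d.+1 + _)%N]addSnnS; lia.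
- by rewrite -tn ltnn subnn !addn0 !binn; lia.
Qed.

(* The excluded tuples are positive on [P]; subtracting 1 there identifies them
   with all the tuples of sum t - #|P|. *)
Lemma card_partitions_vanishing (r t : nat) (P : {set 'I_r.+1}) :
  #|[set u : r.+1.-tuple 'I_t.+1 | (\sum_(x <- u) x == t)%N
        && [exists i in P, tnth u i == 0 :> nat]]| =
  ('C(r + t, r) - (if #|P| <= t then 'C(r + (t - #|P|), r) else 0))%N.
Proof.
set V := [set u : r.+1.-tuple 'I_t.+1 | [exists i in P, tnth u i == 0 :> nat]].
rewrite -card_ord_partitions.
set S := [set u : r.+1.-tuple _ | (\sum_(x <- u) _ == _)%N].
transitivity #|S :&: V|; first by apply: eq_card => u; rewrite !inE.
rewrite -(cardsID V S).
suff -> : #|S :\: V| = (if #|P| <= t then 'C(r + (t - #|P|), r) else 0)%N.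
  by rewrite addnK.
have sumP : (\sum_(i < r.+1) (i \in P) = #|P|)%N.
  by rewrite -sum1_card [RHS]big_mkcond.
have SV u : (u \in S :\: V) = (\sum_(i < r.+1) tnth u i == t)%N
    && [forall i, (i \in P) <= tnth u i]%N.
  rewrite !inE andbC big_tuple; congr (_ && _); rewrite negb_exists.
  apply: eq_forallb => i; case: (i \in P) => //=; by rewrite lt0n.
case: leqP => [Pt|tP]; last first.
  apply: eq_card0 => u; rewrite SV; apply/negP => /andP[/eqP su /forallP Pu].
  by move: tP; rewrite -su -sumP ltnNge leq_sum.
rewrite -card_ord_partitions.
set S' := [set v : r.+1.-tuple _ | (\sum_(x <- v) _ == _)%N].
(* Keeps [inord] from losing anything: an entry is at most [t - #|P|], and 1 is added only when [P]
   is nonempty. *)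
have P1 i : ((i \in P) <= #|P|)%N.
  by rewrite -sumP (bigD1 i) //= leq_addr.
pose f (v : r.+1.-tuple 'I_(t - #|P|).+1) : r.+1.-tuple 'I_t.+1 :=
  [tuple inord (tnth v i + (i \in P)) | i < r.+1].
have fE v i : tnth (f v) i = (tnth v i + (i \in P))%N :> nat.
  rewrite tnth_mktuple inordK //; have := ltn_ord (tnth v i).
  by have := P1 i; lia.
rewrite -(card_imset S' (f := f)); last first.
  move=> v w /(congr1 (@tnth _ _)) vw; apply: eq_from_tnth => i; apply: val_inj.
  by apply: (@addIn (i \in P)); rewrite -!fE vw.
congr #|pred_of_set _|; apply/setP => u; rewrite SV; apply/idP/imsetP.
  case/andP => /eqP su /forallP Pu.
  have suP : (\sum_(i < r.+1) (tnth u i - (i \in P)) = t - #|P|)%N.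
    by rewrite sumnB ?su ?sumP // => i _; exact: Pu.
  exists [tuple inord (tnth u i - (i \in P)) | i < r.+1].
    rewrite inE big_tuple; apply/eqP; rewrite -[RHS]suP; apply: eq_bigr => i _.
    by rewrite tnth_mktuple inordK // ltnS -suP (bigD1 i) //= leq_addr.
  apply: eq_from_tnth => i; apply: val_inj; rewrite /= fE tnth_mktuple inordK.
    by rewrite subnK // Pu.
  by rewrite ltnS -suP (bigD1 i) //= leq_addr.
case=> v; rewrite inE big_tuple => /eqP sv ->; apply/andP; split.
  under eq_bigr do rewrite fE.
  by rewrite big_split /= sv sumP subnK.
by apply/forallP => i; rewrite fE leq_addl.
Qed.

(** * Lattice points in dilates of a hull with one affine relation *)

(** The last two hypotheses say that [lam] spans the affine relations among the [a i], and that
    omitting a point of [P] leaves a unimodular configuration. The first yields uniqueness of the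
    normalized representation, the second its integrality. *)
Lemma lattice_count_conv_circuit (R : realType) (n r t : nat)
    (a : 'I_r.+1 -> 'rV[R]_n) (lam : 'I_r.+1 -> int) (P : {set 'I_r.+1}) :
  (0 < t)%N -> (0 < #|P|)%N ->
  (forall i, a i \is a mxOver Num.int) ->
  {in P, forall i, lam i = 1} -> {in ~: P, forall i, lam i <= 0} ->
  \sum_i lam i = 0 -> \sum_i (lam i)%:~R *: a i = 0 ->
  (forall (c : 'I_r.+1 -> R) (i : 'I_r.+1), i \in P ->
    \sum_j c j = 0 -> \sum_j c j *: a j = 0 ->
    forall j, c j = c i * (lam j)%:~R) ->
  (forall (c : 'I_r.+1 -> R) (i : 'I_r.+1), i \in P -> c i = 0 ->
    \sum_j c j \is a Num.int -> \sum_j c j *: a j \is a mxOver Num.int ->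
    forall j, c j \is a Num.int) ->
  lattice_count (conv a) t =
  #|[set u : r.+1.-tuple 'I_t.+1 | (\sum_(x <- u) x == t)%N
        && [exists i in P, tnth u i == 0 :> nat]]|.
Proof.
move=> t_gt0 /card_gt0P[iP iP_P] aZ lamP lamN lam0 lama dep intc.
set U := [set u | _].
pose phi (u : r.+1.-tuple 'I_t.+1) := \sum_i (tnth u i)%:R *: a i.
have tR : t%:R != 0 :> R by rewrite pnatr_eq0 -lt0n.
have sumU u : u \in U -> \sum_i (tnth u i)%:R = t%:R :> R.
  by rewrite inE big_tuple => /andP[/eqP su _]; rewrite -natr_sum su.
(* Two representations of one point differ by a multiple of [lam], hence by a constant on [P]. Where
   [u] vanishes this constant is an entry of [v], so it is nonnegative; exchanging [u] and [v] makes
   it zero. *)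
have le0U u v j : u \in U -> v \in U -> phi u = phi v ->
    (forall i, i \in P ->
      (tnth v i)%:R - (tnth u i)%:R = (tnth v j)%:R - (tnth u j)%:R :> R) ->
    (tnth u j <= tnth v j)%N.
  rewrite inE => /andP[_ /existsP[i /andP[iP0 /eqP ui]]] vU uv.
  by move=> /(_ i iP0); rewrite ui subr0 -(ler_nat R) -subr_ge0 => <-.
have phi_inj : {in [set` U]%classic &, injective phi}.
  move=> u v /set_mem uU /set_mem vU uv.
  apply: eq_from_tnth => j; apply: val_inj.
  pose c i : R := (tnth u i)%:R - (tnth v i)%:R.
  have c0 : \sum_i c i = 0 by rewrite sumrB !sumU ?subrr.
  have ca : \sum_i c i *: a i = 0.
    under eq_bigr do rewrite scalerBl.
    by rewrite sumrB; apply/eqP; rewrite subr_eq0; apply/eqP.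
  have ciP i : i \in P -> c i = c iP.
    by move=> iP0; rewrite (dep c iP iP_P c0 ca) lamP // mulr1.
  suff : c iP = 0.
    move=> c0'; have := dep c iP iP_P c0 ca j; rewrite c0' mul0r => /eqP.
    by rewrite subr_eq0 eqr_nat => /eqP.
  apply/eqP; rewrite subr_eq0 eqr_nat eqn_leq !(le0U _ _ iP) // => i iP0.
  by rewrite -[LHS]opprB -[RHS]opprB; congr (- _); exact: ciP.
apply: card_fset_set.
suff -> : ([set t%:R *: x | x in conv a]
    `&` [set x | x \is a mxOver Num.int])%classic = (phi @` [set` U])%classic.
  apply: card_eq_trans (inj_card_eq phi_inj) _.
  have -> : ([set` U] = [set` [fset u in enum U]%fset])%classic.
    by apply/seteqP; split => u; rewrite /= in_fset mem_enum.
  apply/card_eq_fsetP; rewrite card_fseq undup_id ?enum_uniq //.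
  by rewrite -cardE.
apply/seteqP; split=> [x [[_ [c [c_ge0 c1 ->]] <-]] | _ [u uU <-]]; last first.
  split; last first.
    apply/mxOverP => p q; rewrite summxE rpred_sum // => i _.
    rewrite mxE; apply: rpredM; first exact: rpred_nat.
    exact: (mxOverP (aZ i)).
  exists (t%:R^-1 *: phi u); last by rewrite scalerA divff ?scale1r.
  exists (fun i => t%:R^-1 * (tnth u i)%:R); split.
  - by move=> i; rewrite mulr_ge0 ?invr_ge0.
  - by rewrite -mulr_sumr sumU // mulVf.
  - by rewrite scaler_sumr; apply: eq_bigr => i _; rewrite scalerA.
rewrite /= => xZ.
(* Only [P] limits the multiple of [lam] to subtract, since [lam] is nonpositive elsewhere; on [P]
   the limit is the least coefficient. *)
case: (arg_minP (fun i => t%:R * c i) iP_P) => l lP lmin.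
pose d i := t%:R * c i - t%:R * c l * (lam i)%:~R.
have dl : d l = 0 by rewrite /d lamP // mulr1 subrr.
have d_ge0 i : 0 <= d i.
  rewrite subr_ge0; case: (boolP (i \in P)) => iP0.
    by rewrite lamP // mulr1 lmin.
  apply: (@le_trans _ _ 0); last by rewrite mulr_ge0.
  by rewrite mulr_ge0_le0 ?mulr_ge0 // lerz0 lamN // inE.
have dt : \sum_i d i = t%:R.
  by rewrite sumrB -!mulr_sumr c1 mulr1 -rmorph_sum lam0 mulr0 subr0.
have dx : \sum_i d i *: a i = t%:R *: \sum_i c i *: a i.
  under eq_bigr do rewrite scalerBl -!scalerA.
  by rewrite sumrB -!scaler_sumr lama !scaler0 subr0.
have dZ i : d i \is a Num.int.
  by apply: (intc d l) => //; rewrite ?dt ?dx.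
have dN i : (Num.truncn (d i))%:R = d i.
  by apply/truncnK; rewrite natrEint dZ d_ge0.
have d_le i : (Num.truncn (d i) <= t)%N.
  by rewrite -(ler_nat R) dN -dt (bigD1 i) //= lerDl sumr_ge0.
pose u := [tuple inord (Num.truncn (d i)) | i < r.+1] : r.+1.-tuple 'I_t.+1.
have uE i : tnth u i = Num.truncn (d i) :> nat.
  by rewrite tnth_mktuple inordK ?ltnS.
exists u.
  rewrite /= inE big_tuple; apply/andP; split.
    rewrite -(eqr_nat R) natr_sum -[X in _ == X]dt; apply/eqP/eq_bigr => i _.
    by rewrite uE dN.
  by apply/existsP; exists l; rewrite uE dl truncn0 andbT.
by rewrite -dx; apply: eq_bigr => i _; rewrite uE dN.
Qed.

(** * The vertices of the toric diagram, with [n = m + 2] *)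

Section ToricDiagram.
Variable m : nat.

(** The side of the relation with coefficients 1: all vertices but a_n and a_(n+1). *)
Definition toric_pos : {set 'I_m.+4} :=
  [set i : 'I_m.+4 | ((i : nat) != m.+1) && ((i : nat) != m.+2)].

Let ltm (i : 'I_m) : ((i : nat) == m.+1 = false) * ((i : nat) == m.+2 = false).
Proof. by split; apply/eqP; have := ltn_ord i; lia. Qed.

Let gtm : ((m == m.+1 = false) * (m == m.+2 = false)) *
  ((m.+3 == m.+1 = false) * (m.+3 == m.+2 = false) * (m.+2 == m.+1 = false)).
Proof. by do ![split]; lia. Qed.

Lemma card_toric_pos : #|toric_pos| = m.+2.
Proof.
rewrite -sum1_card big_mkcond /=; under eq_bigr do rewrite inE.
rewrite !big_ord_recr /= !eqxx !gtm /=.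
under eq_bigr => i _ do rewrite !ltm /=.
by rewrite sum1_card card_ord; lia.
Qed.

Variables (R : realType) (k p q : nat).
Hypotheses (pq : (p + q = m.+2)%N) (qk : (q = p + k)%N).

Let a (i : 'I_m.+4) : 'rV[R]_m.+2 := toric_vertex R m.+2 k i.+1.

(* The 0-based indices m.+1 and m.+2 are those of a_n and a_(n+1), n = m.+2. *)
Definition toric_circuit (i : nat) : int :=
  if i == m.+1 then - p%:Z else if i == m.+2 then - q%:Z else 1.

Lemma sum_toric_circuit : \sum_(i < m.+4) toric_circuit i = 0.
Proof.
rewrite !big_ord_recr /= /toric_circuit !eqxx !gtm /=.
under eq_bigr => i _ do rewrite !ltm /=.
rewrite sumr_const card_ord; lia.
Qed.

(** Entries are written through indicators of the vertex index, so that a sum over vertices picks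
    out single coefficients; the half-integer expression becomes the natural number [q]. *)
Lemma toric_vertexE (i : 'I_m.+4) (j : 'I_m.+2) :
  a i 0 j =
  if j == m.+1 :> nat then (i == m.+2 :> nat)%:R + q%:R * (i == m.+3 :> nat)%:R
  else if j == m :> nat then
    (i == m.+1 :> nat)%:R - (i == m.+2 :> nat)%:R - k%:R * (i == m.+3 :> nat)%:R
  else (i == j.+1 :> nat)%:R - (i == m.+3 :> nat)%:R.
Proof.
have q2 : (m.+2 + k)%:R / 2 = q%:R :> R.
  by rewrite (_ : m.+2 + k = q * 2)%N ?natrM ?mulfK ?pnatr_eq0 //; lia.
have sumE : (\sum_(1 <= l < m.+1) std_basis R m.+2 l) 0 j = (j < m)%:R.
  rewrite summxE; under eq_bigr do rewrite mxE.
  rewrite big_add1 /= big_mkord.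
  case: (ltnP j m) => jm.
    rewrite (bigD1 (Ordinal jm)) //= eqxx big1 ?addr0 // => l /eqP lj.
    by case: eqP => // -[jl]; case: lj; apply: val_inj.
  by rewrite big1 // => l _; case: eqP => // -[jl]; move: (ltn_ord l); lia.
have jm := ltn_ord j; have im := ltn_ord i.
rewrite /a /toric_vertex q2 /= !eqSS.
case: ifP => [/eqP -> | i0].
  by rewrite mxE; repeat case: eqP => ? //=; lra.
case: ifP => im2.
  by rewrite mxE; repeat (case: eqP => ? //=; try lia); lra.
case: ifP => [/eqP im3|im3].
  by rewrite !mxE; repeat (case: eqP => ? //=; try lia); lra.
rewrite !(mxE, sumE).
case: ltnP => ?; repeat (case: eqP => ? //=; try lia); lra.
Qed.


Lemma sum_toric_vertex (c : 'I_m.+4 -> R) (x := \sum_i c i *: a i) (j : nat) :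
  (j < m.+2)%N ->
  x 0 (inord j) =
  if j == m.+1 then c (inord m.+2) + q%:R * c (inord m.+3)
  else if j == m then c (inord m.+1) - c (inord m.+2) - k%:R * c (inord m.+3)
  else c (inord j.+1) - c (inord m.+3).
Proof.
move=> jm.
have pick l : (l < m.+4)%N -> \sum_i c i * (i == l :> nat)%:R = c (inord l).
  move=> lm; rewrite (bigD1 (inord l)) //= inordK // eqxx mulr1 big1 ?addr0 //.
  move=> i.
  by rewrite -val_eqE /= inordK // => /negPf ->; rewrite mulr0.
rewrite /x summxE; under eq_bigr do rewrite mxE toric_vertexE inordK //.
case: ifP => [_|_]; last case: ifP => [_|_].
- under eq_bigr do rewrite mulrDr mulrCA.
  by rewrite big_split -mulr_sumr /= !pick.
- under eq_bigr do rewrite !mulrBr mulrCA.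
  by rewrite !sumrB -mulr_sumr !pick //; lia.
- under eq_bigr do rewrite mulrBr.
  by rewrite sumrB !pick //; lia.
Qed.

(* Moving along the circuit kills the last coefficient; the other vertices form
   a unimodular simplex, so the remaining coefficients are integral combinations
   of the entries of [x] and of the total weight. *)
Lemma toric_barycentric (c : 'I_m.+4 -> R) (x := \sum_i c i *: a i)
    (i : 'I_m.+4) :
  c i = c ord_max * (toric_circuit i)%:~R +
  if i == 0%N :> nat then \sum_i c i - \sum_(j < m) x 0 (inord j)
     - x 0 (inord m) - 2 * x 0 (inord m.+1)
  else if i == m.+1 :> nat then x 0 (inord m) + x 0 (inord m.+1)
  else if i == m.+2 :> nat then x 0 (inord m.+1)
  else if i == m.+3 :> nat then 0
  else x 0 (inord i.-1).
Proof.
have pR : p%:R + q%:R = m%:R + 2 :> R by rewrite -natrD pq -addn2 natrD.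
have qR : q%:R = p%:R + k%:R :> R by rewrite qk natrD.
have -> : c ord_max = c (inord m.+3).
  by congr c; apply: val_inj; rewrite /= inordK.
rewrite -[in LHS](inord_val i); have im := ltn_ord i.
have xm1 : x 0 (inord m.+1) = c (inord m.+2) + q%:R * c (inord m.+3).
  by rewrite sum_toric_vertex // eqxx.
have xm : x 0 (inord m) =
    c (inord m.+1) - c (inord m.+2) - k%:R * c (inord m.+3).
  by rewrite sum_toric_vertex // gtm eqxx.
have xj j : (j < m)%N -> x 0 (inord j) = c (inord j.+1) - c (inord m.+3).
  by move=> jm; rewrite sum_toric_vertex ?(ltm (Ordinal jm)) ?ltn_eqF //; lia.
(* Since a_1 = 0 does not show in [x], its coefficient comes from the total weight. The factor 2
   arises because the last coordinate enters the coefficients of both a_n and a_(n+1). *)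
rewrite /toric_circuit; case: (eqVneq (i : nat) 0%N) => [->|i0].
  have -> : \sum_i c i = c (inord 0) + \sum_(j < m) c (inord j.+1)
      + c (inord m.+1) + c (inord m.+2) + c (inord m.+3).
    rewrite (eq_bigr (fun l : 'I_m.+4 => c (inord l))) => [|l _].
      by rewrite 3!big_ord_recr big_ord_recl.
    by rewrite inord_val.
  rewrite (eq_bigr _ (fun (j : 'I_m) _ => xj j (ltn_ord j))).
  rewrite sumrB sumr_const card_ord -[_ *+ m]mulr_natr xm xm1 /=.
  have {}pR : m%:R = p%:R + q%:R - 2 :> R by rewrite pR addrK.
  rewrite pR qR; ring.
case: eqP => [->|im1].
  by rewrite xm xm1 mulrNz -pmulrn qR; ring.
case: eqP => [->|im2]; first by rewrite xm1 mulrNz -pmulrn; ring.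
case: eqP => [->|im3]; first by rewrite mulr1 addr0.
by rewrite xj ?prednK ?lt0n //; [ring | lia].
Qed.

Lemma sum_toric_circuit_vertex :
  \sum_(i < m.+4) (toric_circuit i)%:~R *: a i = 0.
Proof.
apply/rowP => j; rewrite -[j]inord_val sum_toric_vertex // mxE.
have pR : p%:R + q%:R = m%:R + 2 :> R by rewrite -natrD pq -addn2 natrD.
have qR : q%:R = p%:R + k%:R :> R by rewrite qk natrD.
have jm := ltn_ord j.
rewrite /toric_circuit !inordK; try by lia.
rewrite !gtm !eqxx.
case: eqP => jm1; first by rewrite mulrNz -pmulrn; ring.
case: eqP => jm2; first by rewrite !mulrNz -!pmulrn qR; ring.
by rewrite !eqSS !ltn_eqF ?subrr //; lia.
Qed.

Lemma toric_vertex_int (i : 'I_m.+4) : a i \is a mxOver Num.int.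
Proof.
apply/mxOverP => z j; rewrite ord1 toric_vertexE.
by do 2?[case: ifP => _];
  do ?[exact: rpred_nat | apply: rpredB | apply: rpredD | apply: rpredM].
Qed.

(** The second summand of [toric_barycentric] vanishes, and the factor [c ord_max] equals [c i]
    because the circuit is 1 at [i]. *)
Lemma toric_dependence (c : 'I_m.+4 -> R) (i : 'I_m.+4) : i \in toric_pos ->
  \sum_j c j = 0 -> \sum_j c j *: a j = 0 ->
  forall j, c j = c i * (toric_circuit j)%:~R.
Proof.
rewrite inE => /andP[/negPf im1 /negPf im2] c0 cx.
have dep j : c j = c ord_max * (toric_circuit j)%:~R.
  rewrite [LHS]toric_barycentric cx c0 big1 ?mxE => [|l _]; last by rewrite mxE.
  by rewrite mulr0 !subr0 add0r !if_same addr0.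
by move=> j; rewrite (dep j) (dep i) {2}/toric_circuit im1 im2 mulr1.
Qed.

(** The second summand of [toric_barycentric] is integral. At [i] it equals [- c ord_max], so
    [c ord_max] is an integer and all coefficients follow. *)
Lemma toric_coeff_int (c : 'I_m.+4 -> R) (i : 'I_m.+4) : i \in toric_pos ->
  c i = 0 -> \sum_j c j \is a Num.int ->
  \sum_j c j *: a j \is a mxOver Num.int ->
  forall j, c j \is a Num.int.
Proof.
rewrite inE => /andP[/negPf im1 /negPf im2] ci cZ /mxOverP xZ.
have intE j : c j - c ord_max * (toric_circuit j)%:~R \is a Num.int.
  rewrite [c j]toric_barycentric addrAC subrr add0r.
  by do 4?[case: ifP => _];
    do ?[exact: rpred0 | exact: xZ | exact: rpred_nat | exact: rpred_sum
        | apply: rpredB | apply: rpredD | apply: rpredM].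
have cmaxZ : c ord_max \is a Num.int.
  by have := intE i; rewrite ci /toric_circuit im1 im2 mulr1 sub0r rpredN.
move=> j; rewrite -[c j](subrK (c ord_max * (toric_circuit j)%:~R)).
by rewrite rpredD // rpredM // rpred_int.
Qed.

End ToricDiagram.

(** * The polynomial of the toric diagram *)

Theorem theorem10p7 (R : realType) (n k : nat) :
  (2 <= n)%N -> (k < n)%N -> (k = n %[mod 2])%N ->
  is_hstar_poly (toric_diagram R n k) (\sum_(0 <= i < n) 'X^i).
Proof.
case: n => [|[|m]] // _ km kn r.
(* Equal parity makes [n - k] even; [p + k] is then (n + k)/2. *)
have [p qk pq] : exists2 p, (0 < p)%N & (p + (p + k) = m.+2)%N.
  by exists ((m.+2 - k) %/ 2)%N; lia.
have -> : (\sum_(0 <= i < m.+2) 'X^i : {poly int})`_r = (r < m.+2)%N%:R.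
  rewrite coef_sum; under eq_bigr do rewrite coefXn.
  rewrite big_mkord; case: ltnP => rm.
    rewrite (bigD1 (Ordinal rm)) //= eqxx big1 ?addr0 // => i.
    by rewrite eq_sym -val_eqE /= => /negPf ->.
  by rewrite big1 // => i _; rewrite gtn_eqF // (leq_trans (ltn_ord i)).
(* The exponent n + 1 = [m.+3] is one less than the number of vertices. The constant term is 1 by
   convention and is matched separately. *)
rewrite -(@cauchy_prod_binomial_diff _ m.+3) //; apply: eq_cauchy_prod => -[|t].
  by rewrite addn0 binn subr0.
rewrite /ehrhart_series /toric_diagram.
rewrite (@lattice_count_conv_circuit _ _ _ _ _ (toric_circuit m p (p + k))
  (toric_pos m)) //.
- rewrite card_partitions_vanishing card_toric_pos; case: leqP => tm.
    by rewrite subn0 subr0.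
  (* Monotonicity of the binomial shows that the subtraction of naturals is not truncated. *)
  by rewrite subzn // leq_bin2l // leq_add2l leq_subr.
- by rewrite card_toric_pos.
- exact: toric_vertex_int pq _.
- by move=> i; rewrite inE /toric_circuit => /andP[/negPf -> /negPf ->].
- move=> i; rewrite !inE negb_and !negbK /toric_circuit => /orP[] /eqP ->.
    by rewrite eqxx; lia.
  by rewrite eqxx; case: eqP; lia.
- exact: sum_toric_circuit.
- exact: sum_toric_circuit_vertex pq erefl.
- exact: toric_dependence pq erefl.
- exact: toric_coeff_int pq erefl.
Qed.
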